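(* Let $N,k$ be positive integers with $N\ge 2k+1$, and let $G$ be a connected $r$-regular graph on $m$ vertices. Assume that for each $\alpha=1,\ldots,t$ all roots of $D_{k,\nu_\alpha}(x)$ are simple. Put $$\mathcal R_{N,k,G}(\ell;a,b)=\frac{m(2k+r)}{2}\sum_{\alpha=1}^{t}\sum_{j=0}^{N-1}\frac{E_\alpha(b,b)-E_\alpha(a,b)\cos(\ell\theta_j)}{D_{k,\nu_\alpha}(2\cos\theta_j)}.$$ Then, for $a,b\in V(G)$ and $0\le\ell\le N-1$, $$\mathcal R_{N,k,G}(\ell;a,b)=-\frac{m(2k+r)}{2}\sum_{\alpha=1}^{t}\sum_{c=1}^{k}\frac{E_\alpha(b,b)\mathcal G_{\alpha,c}(0)-E_\alpha(a,b)\mathcal G_{\alpha,c}(\ell)}{D_{k,\nu_\alpha}'(\phi_{\alpha,c})}.$$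
   Context: All graphs are finite, simple and undirected. $\theta_j=2\pi j/N$. $L_G=rI_m-A_G$ is the Laplacian of $G$, with distinct eigenvalues $0=\nu_0<\nu_1<\cdots<\nu_t$; $E_\alpha$ is the orthogonal projection onto the $\nu_\alpha$-eigenspace, with entries $E_\alpha(a,b)$. For $\nu>0$, $D_{k,\nu}(x)=k+\frac{\nu}{2}-\sum_{s=1}^{k}T_s\left(\frac{x}{2}\right)$, where $T_s$ is the Chebyshev polynomial of the first kind; it has degree $k$. When the roots of $D_{k,\nu_\alpha}$ are simple they are denoted $\phi_{\alpha,1},\ldots,\phi_{\alpha,k}\in\mathbb C$. For each $\alpha\in\{1,\ldots,t\}$ and $c\in\{1,\ldots,k\}$ choose $\rho_{\alpha,c}\in\mathbb C$ with $\rho_{\alpha,c}+\rho_{\alpha,c}^{-1}=\phi_{\alpha,c}$, and define $$\mathcal G_{\alpha,c}(\ell)=\frac{N\left(\rho_{\alpha,c}^{\ell}+\rho_{\alpha,c}^{N-\ell}\right)}{\left(\rho_{\alpha,c}-\rho_{\alpha,c}^{-1}\right)\left(\rho_{\alpha,c}^{N}-1\right)}.$$ *)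

(* Defs.v *)
From HB Require Import structures.
From mathcomp Require Import all_boot all_order all_algebra.
From mathcomp Require Import all_classical all_reals all_analysis.
From mathcomp Require Import complex.

Set Implicit Arguments.
Unset Strict Implicit.
Unset Printing Implicit Defensive.

Import Order.TTheory GRing.Theory Num.Theory.
Local Open Scope ring_scope.
Local Open Scope complex_scope.

Definition simple_graph (V : finType) (e : rel V) : Prop :=
  symmetric e /\ irreflexive e.

Definition regular_graph (V : finType) (e : rel V) (r : nat) : Prop :=
  forall x, #|[set y | e x y]| = r.

Definition connected_graph (V : finType) (e : rel V) : Prop :=
  forall x y, connect e x y.

Section Laplacian.
Variables (R : realType) (m : nat).

Definition adjacency (e : rel 'I_m) : 'M[R]_m :=
  \matrix_(i, j) (e i j)%:R.

Definition laplacian (r : nat) (e : rel 'I_m) : 'M[R]_m :=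
  r%:R%:M - adjacency e.

(* nu_0 < nu_1 < ... < nu_t are exactly the distinct eigenvalues of M.  For the
   Laplacian of a regular graph, nu_0 = 0 follows and is proved below
   (distinct_eigenvalues_laplacian0). *)
Definition distinct_eigenvalues (t : nat) (M : 'M[R]_m) (nu : 'I_t.+1 -> R) :
  Prop :=
  (forall i j : 'I_t.+1, (i < j)%N -> nu i < nu j) /\
  (forall x : R, eigenvalue M x <-> exists i, nu i = x).

(* Subspaces of R^m are row spaces: kermx U^T is the orthogonal complement of
   the row space of U, and proj_mx A B is the projection onto A along B,
   acting on row vectors.  orth_projP shows that they are complementary. *)
Definition orth_proj (U : 'M[R]_m) : 'M[R]_m := proj_mx U (kermx U^T).

Definition eigenproj (M : 'M[R]_m) (x : R) : 'M[R]_m :=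
  orth_proj (eigenspace M x).

Lemma normrow_eq0 (u : 'rV[R]_m) : u *m u^T = 0 -> u = 0.
Proof.
move=> /matrixP /(_ ord0 ord0); rewrite !mxE => /eqP.
rewrite psumr_eq0 => [/allP u0|i _]; last by rewrite mxE -expr2 sqr_ge0.
apply/rowP => i; rewrite mxE; apply/eqP.
have := u0 i; rewrite mem_index_enum => /(_ isT) /=.
by rewrite mxE mulf_eq0 orbb.
Qed.

Lemma orth_cap0 (U : 'M[R]_m) : (U :&: kermx U^T = 0)%MS.
Proof.
apply/eqP; rewrite -submx0; apply/rV_subP => u.
rewrite sub_capmx => /andP[/submxP[x ->] /sub_kermxP xU].
rewrite submx0; apply/eqP/normrow_eq0.
by rewrite trmx_mul mulmxA xU mul0mx.
Qed.

Lemma orth_sum1 (U : 'M[R]_m) : (1%:M <= U + kermx U^T)%MS.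
Proof.
rewrite sub1mx /row_full eqn_leq rank_leq_col /=.
rewrite mxrank_disjoint_sum ?orth_cap0 //.
by rewrite mxrank_ker mxrank_tr subnKC ?rank_leq_row.
Qed.

Lemma orth_projP (U : 'M[R]_m) (u : 'rV[R]_m) :
  (u *m orth_proj U <= U)%MS /\ (u - u *m orth_proj U) *m U^T = 0.
Proof.
split; first exact: proj_mx_sub.
apply/sub_kermxP; apply: proj_mx_compl_sub.
exact: submx_trans (submx1 u) (orth_sum1 U).
Qed.

Lemma laplacian_form (r : nat) (e : rel 'I_m) (v : 'rV[R]_m) :
  simple_graph e -> regular_graph e r ->
  (v *m laplacian r e *m v^T) 0 0 *+ 2 =
  \sum_i \sum_(j | e i j) (v 0 i - v 0 j) ^+ 2.
Proof.
move=> [es _] er.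
have deg i : (\sum_(j | e i j) (1 : R)) = r%:R.
  by rewrite sumr_const -(er i) cardsE.
have E : \sum_i \sum_(j | e i j) v 0 j ^+ 2 = \sum_i r%:R * v 0 i ^+ 2.
  rewrite (exchange_big_dep xpredT) //=; apply: eq_bigr => j _.
  rewrite -(deg j) mulr_suml; apply: eq_big => [i|i _]; first by rewrite es.
  by rewrite mul1r.
have F : \sum_i \sum_(j | e i j) v 0 i ^+ 2 = \sum_i r%:R * v 0 i ^+ 2.
  apply: eq_bigr => i _; rewrite -(deg i) mulr_suml.
  by apply: eq_bigr => j _; rewrite mul1r.
have A : (v *m adjacency e *m v^T) 0 0 = \sum_i \sum_(j | e i j) v 0 i * v 0 j.
  rewrite [RHS](exchange_big_dep xpredT) //= mxE; apply: eq_bigr => j _.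
  rewrite !mxE mulr_suml [RHS]big_mkcond /=; apply: eq_bigr => i _.
  by rewrite !mxE; case: (e i j); rewrite ?mulr1 ?mulr0 ?mul0r.
have B : (v *m r%:R%:M *m v^T) 0 0 = \sum_i r%:R * v 0 i ^+ 2.
  rewrite mul_mx_scalar -scalemxAl !mxE mulr_sumr; apply: eq_bigr => i _.
  by rewrite mxE expr2.
have split_sq i j : (v 0 i - v 0 j) ^+ 2 =
    v 0 i ^+ 2 + v 0 j ^+ 2 - (v 0 i * v 0 j) *+ 2.
  by rewrite sqrrB addrAC.
rewrite /laplacian mulmxBr mulmxBl mxE B mxE A mulrnBl mulr2n.
rewrite -{1}F -E -big_split /= -sumrMnl -sumrB; apply: eq_bigr => i _.
rewrite -big_split /= -sumrMnl -sumrB; apply: eq_bigr => j _.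
by rewrite split_sq.
Qed.

Lemma distinct_eigenvalues_laplacian0 (r t : nat) (e : rel 'I_m)
    (nu : 'I_t.+1 -> R) (a : 'I_m) :
  simple_graph e -> regular_graph e r ->
  distinct_eigenvalues (laplacian r e) nu -> nu ord0 = 0.
Proof.
move=> es er [inc spec].
have nu0_ge0 : 0 <= nu ord0.
  have /eigenvalueP[v vL v0] : eigenvalue (laplacian r e) (nu ord0).
    by apply/spec; exists ord0.
  have := laplacian_form v es er; rewrite vL -scalemxAl mxE => Q.
  have vv : 0 < (v *m v^T) 0 0.
    have vv0 : 0 <= (v *m v^T) 0 0.
      by rewrite mxE sumr_ge0 // => i _; rewrite mxE -expr2 sqr_ge0.
    rewrite lt_def vv0 andbT; apply: contra_neq v0 => vv0'.
    by apply: normrow_eq0; apply/matrixP => i j; rewrite !ord1 vv0' mxE.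
  rewrite -(pmulr_lge0 _ vv) -(pmulrn_lge0 _ (ltn0Sn 1)) Q.
  by apply: sumr_ge0 => i _; apply: sumr_ge0 => j _; exact: sqr_ge0.
have /spec [i nui] : eigenvalue (laplacian r e) 0.
  apply/eigenvalueP; exists (const_mx 1); last first.
    apply/eqP => /rowP /(_ a); rewrite !mxE => /eqP; exact/negP/oner_neq0.
  rewrite scale0r mulmxBr mul_mx_scalar; apply/rowP => j; rewrite !mxE.
  have -> : (r%:R : R) = \sum_i (e j i)%:R.
    rewrite -(er j) -sum1dep_card natr_sum big_mkcond.
    by apply: eq_bigr => i _; case: (e j i).
  rewrite mulr1; apply/eqP; rewrite subr_eq0; apply/eqP/eq_bigr => i _.
  by rewrite !mxE mul1r es.1.
apply/eqP; rewrite eq_le nu0_ge0 andbT -nui.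
have [->//|i0] := eqVneq i ord0; apply/ltW/inc.
by rewrite lt0n.
Qed.

End Laplacian.

Fixpoint chebyshevT (F : fieldType) (n : nat) : {poly F} :=
  match n with
  | 0 => 1
  | n'.+1 => match n' with
             | 0 => 'X
             | n''.+1 => 2%:R *: ('X * chebyshevT F n') - chebyshevT F n''
             end
  end.

Definition Dpoly (F : fieldType) (k : nat) (nu : F) : {poly F} :=
  (k%:R + nu / 2%:R)%:P
  - \sum_(1 <= s < k.+1) (chebyshevT F s \Po (2%:R^-1 *: 'X)).

Definition DpolyC (R : realType) (k : nat) (nu : R) : {poly R[i]} :=
  map_poly (real_complex R) (Dpoly k nu).

Definition all_roots_simple (F : fieldType) (p : {poly F}) : Prop :=
  forall z, root p z -> mup z p = 1%N.

Definition enumerates_roots (F : fieldType) (n : nat) (p : {poly F})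
    (phi : 'I_n -> F) : Prop :=
  injective phi /\ (forall z, root p z <-> exists c, phi c = z).

Definition theta (R : realType) (N j : nat) : R := 2%:R * pi * j%:R / N%:R.

Definition Rsum (R : realType) (N k r m t : nat) (L : 'M[R]_m)
    (nu : 'I_t.+1 -> R) (l : nat) (a b : 'I_m) : R :=
  (m * (2 * k + r))%:R / 2%:R *
  \sum_(alpha < t.+1 | (0 < alpha)%N) \sum_(j < N)
    (eigenproj L (nu alpha) b b
     - eigenproj L (nu alpha) a b * cos (l%:R * theta R N j))
    / (Dpoly k (nu alpha)).[2%:R * cos (theta R N j)].

(* Only used for l <= N, so the subtraction in nat is the true one. *)
Definition Gfun (F : fieldType) (N : nat) (rho : F) (l : nat) : F :=
  N%:R * (rho ^+ l + rho ^+ (N - l)) / ((rho - rho^-1) * (rho ^+ N - 1)).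

(* Main.v *)
Require Import Defs.
From HB Require Import structures.
From mathcomp Require Import all_boot all_order all_algebra.
From mathcomp Require Import all_classical all_reals all_analysis.
From mathcomp Require Import complex.
From mathcomp Require Import ring lra.

Set Implicit Arguments.
Unset Strict Implicit.
Unset Printing Implicit Defensive.

Import Order.TTheory GRing.Theory Num.Theory.
Local Open Scope ring_scope.
Local Open Scope complex_scope.

(** Expanding 1 / D_(k,nu) in partial fractions over its simple roots reduces
    the identity to the evaluation of
      \sum_j cos(l theta_j) / (2 cos theta_j - (rho + rho^-1)).
    Two geometric sums show that the discrete Fourier transform over Z/N of
    l |-> rho^l + rho^(N-l) at z = exp(i theta_j) is
      - (rho - rho^-1) (rho^N - 1) / (z + z^-1 - (rho + rho^-1)),
    so Fourier inversion gives - Gfun N rho l.  No denominator vanishes, because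
    D_(k,nu) (2 cos x) >= nu / 2 > 0 for every real x. *)

(** * Partial fractions for a polynomial with simple roots *)

Section PartialFractions.
Variables (F : fieldType) (k : nat) (p : {poly F}) (phi : 'I_k -> F).
Hypotheses (p_neq0 : p != 0) (size_p : (size p <= k.+1)%N).
Hypotheses (phi_inj : injective phi) (phi_root : forall c, root p (phi c)).

Let rs := [seq phi c | c <- enum 'I_k].

Let size_rs : size rs = k.
Proof. by rewrite size_map size_enum_ord. Qed.

Let uniq_rs : uniq rs.
Proof. by rewrite map_inj_uniq ?enum_uniq. Qed.

Let root_rs : all (root p) rs.
Proof. by apply/allP => _ /mapP[c _ ->]. Qed.

(** Having [k] distinct roots forces [size p > k], so the bound [size_p] is attained and no factor
    other than a constant is left. *)
Lemma poly_eq_prod_roots : p = lead_coef p *: \prod_c ('X - (phi c)%:P).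
Proof.
rewrite {1}(@all_roots_prod_XsubC _ p rs) //; last by rewrite uniq_rootsE.
  by rewrite big_map big_enum.
apply/eqP; rewrite eqn_leq size_rs size_p /= -{1}size_rs.
exact: max_poly_roots.
Qed.

(** Divided by its value at [phi c], this is the Lagrange basis polynomial of the node [phi c]. *)
Let Q c := \prod_(d | d != c) ('X - (phi d)%:P).

Let p_factor c : p = lead_coef p *: (('X - (phi c)%:P) * Q c).
Proof. by rewrite {1}poly_eq_prod_roots (bigD1 c). Qed.

Let Q_neq0 c : (Q c).[phi c] != 0.
Proof.
rewrite horner_prod; apply/prodf_neq0 => d dc.
by rewrite hornerXsubC subr_eq0 (inj_eq phi_inj) eq_sym.
Qed.

Let Q_eq0 c d : d != c -> (Q c).[phi d] = 0.
Proof.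
by move=> dc; rewrite /Q (bigD1 d) //= hornerM hornerXsubC subrr mul0r.
Qed.

Let deriv_phi c : p^`().[phi c] = lead_coef p * (Q c).[phi c].
Proof.
rewrite {1}(p_factor c) derivZ derivM derivXsubC mul1r hornerZ hornerD.
by rewrite hornerM hornerXsubC subrr mul0r addr0.
Qed.

Lemma inv_horner_partial_fractions x : (0 < k)%N -> p.[x] != 0 ->
  p.[x]^-1 = \sum_c (p^`().[phi c] * (x - phi c))^-1.
Proof.
move=> k_gt0 px.
(* Lagrange interpolation of the constant 1 at the roots *)
have lagrange1 : \sum_c (Q c).[phi c]^-1 *: Q c = 1.
  apply/eqP; rewrite -subr_eq0.
  apply/eqP/(@roots_geq_poly_eq0 _ _ rs) => //.
    apply/allP => _ /mapP[d _ ->]; rewrite rootE hornerD hornerN hornerC.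
    rewrite horner_sum (bigD1 d) //= big1 => [|c cd].
      by rewrite hornerZ mulVf // addr0 subrr.
    by rewrite hornerZ (@Q_eq0 c d) ?mulr0 // eq_sym.
  (* The difference vanishes at [k] distinct points, so size at most [k] makes it zero. Each [Q c]
     has [k - 1] linear factors, and the constant 1 fits because [k > 0]. *)
  rewrite size_rs (leq_trans (size_polyD _ _)) // geq_max size_polyN size_poly1.
  rewrite k_gt0 andbT (leq_trans (size_sum _ _ _)) //.
  apply/bigmax_leqP => c _; rewrite (leq_trans (size_scale_leq _ _)) //.
  rewrite /Q -big_filter size_prod_XsubC size_filter.
  have := cardC1 c; rewrite card_ord cardE /enum_mem size_filter => -> .
  by rewrite prednK.
(* Multiplying by the interpolated 1 evaluated at [x], the factor [(Q c).[x]] cancels against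
   [p.[x]], and [(Q c).[phi c]] times the leading coefficient is the derivative at [phi c]. *)
rewrite -[LHS]mulr1.
have <- : (\sum_c (Q c).[phi c]^-1 *: Q c).[x] = 1.
  by rewrite lagrange1 hornerC.
rewrite horner_sum mulr_sumr.
apply: eq_bigr => c _; rewrite hornerZ deriv_phi.
have := px; rewrite (p_factor c) hornerZ hornerM hornerXsubC.
rewrite !mulf_eq0 !negb_or => /and3P[lc xc Qc].
have := Q_neq0 c; move: lc.
rewrite -(p_factor c) => lc Qcc; by field; rewrite Qc xc lc Qcc.
Qed.

End PartialFractions.

(** * Fourier inversion on Z/N *)

Section DiscreteFourier.
Variables (F : fieldType) (N : nat).

Lemma sum_prim_root_orthogonal (w : F) (i l : nat) :
  N.-primitive_root w -> (i < N)%N -> (l < N)%N ->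
  \sum_(j < N) (w ^+ j) ^+ l * (w ^+ j)^-1 ^+ i = N%:R * (i == l)%:R.
Proof.
move=> w_prim iN lN; set x := w ^+ l / w ^+ i.
have w_neq0 : w != 0.
  by rewrite (prim_root_eq0 w_prim) -lt0n (leq_ltn_trans _ iN).
have -> : \sum_(j < N) (w ^+ j) ^+ l * (w ^+ j)^-1 ^+ i = \sum_(j < N) x ^+ j.
  apply: eq_bigr => j _; rewrite expr_div_n exprVn.
  by rewrite -!exprM mulnC (mulnC i).
have [eq_il | il] := eqVneq i l.
  rewrite mulr1 /x eq_il; under eq_bigr => j _ do rewrite divff ?expf_neq0 // expr1n.
  by rewrite sumr_const card_ord.
have xN : x ^+ N = 1.
  by rewrite expr_div_n !(exprAC _ _ N) (prim_expr_order w_prim) !expr1n divr1.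
(* The geometric sum times [x - 1] is [x ^+ N - 1 = 0]; and [x = 1] would give [w ^+ l = w ^+ i],
   hence [l = i] as both are below [N]. *)
rewrite mulr0; apply/eqP; move: (subrX1 x N); rewrite xN subrr => /esym/eqP.
rewrite mulf_eq0 subr_eq0 => /orP[|//].
rewrite -[X in _ == X](divff (expf_neq0 i w_neq0)).
rewrite (inj_eq (mulIf _)) ?invr_eq0 ?expf_neq0 //.
by rewrite (eq_prim_root_expr w_prim) !modn_small // eq_sym (negPf il).
Qed.

(** The sum splits into geometric series of ratios [rho / z] and [(rho * z)^-1]. As [z ^+ N = 1],
    their numerators are [rho ^+ N - 1] and, after the factor [rho ^+ N], its opposite. *)
Lemma sum_symmetric_powers (z rho : F) :
  z ^+ N = 1 -> z != 0 -> rho != 0 -> z + z^-1 - (rho + rho^-1) != 0 ->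
  \sum_(i < N) (rho ^+ i + rho ^+ (N - i)) * z^-1 ^+ i
  = - ((rho - rho^-1) * (rho ^+ N - 1)) / (z + z^-1 - (rho + rho^-1)).
Proof.
move=> zN z0 rho0 nz.
(* By this factorization, the nonvanishing hypothesis says that neither geometric ratio equals 1. *)
have fact : z + z^-1 - (rho + rho^-1) = (rho - z) * (1 - rho * z) / (rho * z).
  by field; rewrite z0 rho0.
move: nz; rewrite fact !mulf_eq0 !negb_or => /andP[/andP[nz1 nz2] _].
have geom (x : F) : x != 1 -> \sum_(i < N) x ^+ i = (x ^+ N - 1) / (x - 1).
  by move=> x1; rewrite subrX1 mulrC mulKf // subr_eq0.
have split_term (i : 'I_N) : (rho ^+ i + rho ^+ (N - i)) * z^-1 ^+ i
    = (rho / z) ^+ i + rho ^+ N * (rho * z)^-1 ^+ i.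
  rewrite mulrDl expr_div_n !exprVn exprMn invfM expfB_cond ?mulrA //.
  by rewrite (negPf rho0) /= add0n; exact/ltnW/ltn_ord.
rewrite (eq_bigr _ (fun i _ => split_term i)) big_split /= -mulr_sumr.
have x1 : rho / z != 1.
  by apply: contra nz1 => /eqP x1; rewrite -[rho](divfK z0) x1 mul1r subrr.
have y1 : (rho * z)^-1 != 1.
  by rewrite invr_eq1 eq_sym -subr_eq0.
rewrite !geom // expr_div_n exprVn exprMn zN divr1 mulr1.
have := expf_neq0 N rho0; set r := rho ^+ N => r0.
by field; rewrite z0 rho0 r0 nz1 nz2 -?opprB ?oppr_eq0.
Qed.

Lemma Gfun_fourier (w rho : F) (l : nat) :
  N.-primitive_root w -> rho != 0 -> rho - rho^-1 != 0 -> rho ^+ N != 1 ->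
  (forall j : 'I_N, w ^+ j + (w ^+ j)^-1 - (rho + rho^-1) != 0) ->
  (l < N)%N ->
  \sum_(j < N) (w ^+ j) ^+ l / (w ^+ j + (w ^+ j)^-1 - (rho + rho^-1))
  = - Gfun N rho l.
Proof.
move=> w_prim rho0 rho1 rhoN nz lN.
have w_neq0 : w != 0.
  by rewrite (prim_root_eq0 w_prim) -lt0n (leq_ltn_trans _ lN).
set K := (rho - rho^-1) * (rho ^+ N - 1).
have K0 : K != 0 by rewrite mulf_neq0 // subr_eq0.
have inv_fourier (j : 'I_N) : (w ^+ j + (w ^+ j)^-1 - (rho + rho^-1))^-1
    = - K^-1 * \sum_(i < N) (rho ^+ i + rho ^+ (N - i)) * (w ^+ j)^-1 ^+ i.
  rewrite sum_symmetric_powers ?expf_neq0 //.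
    by rewrite -/K !mulNr mulrN opprK mulKf.
  by rewrite exprAC (prim_expr_order w_prim) expr1n.
under eq_bigr => j _ do rewrite inv_fourier !mulr_sumr.
(* After the exchange, orthogonality keeps only the index [i = l]. *)
rewrite exchange_big /= (bigD1 (Ordinal lN)) //= [X in _ + X]big1 => [|i il].
  rewrite addr0.
  transitivity (- K^-1 * (rho ^+ l + rho ^+ (N - l)) *
      \sum_(j < N) (w ^+ j) ^+ l * (w ^+ j)^-1 ^+ l).
    by rewrite mulr_sumr; apply: eq_bigr => j _; ring.
  by rewrite sum_prim_root_orthogonal // eqxx mulr1 /Gfun -/K; ring.
transitivity (- K^-1 * (rho ^+ i + rho ^+ (N - i)) *
    \sum_(j < N) (w ^+ j) ^+ l * (w ^+ j)^-1 ^+ i).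
  by rewrite mulr_sumr; apply: eq_bigr => j _; ring.
rewrite sum_prim_root_orthogonal // -[_ == l]/(i == Ordinal lN) (negPf il).
by rewrite !mulr0.
Qed.

End DiscreteFourier.

(** Lets Fourier inversion be applied at both [w] and [w^-1], whose powers add up to cosines. *)
Lemma primitive_rootV (F : fieldType) (n : nat) (w : F) :
  n.-primitive_root w -> n.-primitive_root w^-1.
Proof.
rewrite /primitive_root_of_unity => /andP[-> /forallP wP]; apply/forallP => i.
by have := wP i; rewrite !unity_rootE exprVn invr_eq1.
Qed.

(** * Degree bounds *)

Section Chebyshev.
Variable F : fieldType.

Lemma size_chebyshevT n : (size (chebyshevT F n) <= n.+1)%N.
Proof.
suff [] : (size (chebyshevT F n) <= n.+1)%N /\
  (size (chebyshevT F n.+1) <= n.+2)%N by [].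
elim: n => [|n [IH1 IH2]]; first by rewrite size_poly1 size_polyX.
split=> //; rewrite [chebyshevT _ _]/(2%:R *: ('X * chebyshevT F n.+1) -
  chebyshevT F n).
move: (chebyshevT F n) (chebyshevT F n.+1) IH1 IH2 => p q size_p size_q.
apply: leq_trans (size_polyD _ _) _; rewrite geq_max size_polyN; apply/andP.
split; last exact/(leq_trans size_p)/ltnW.
apply: leq_trans (size_scale_leq _ _) _.
by apply: leq_trans (size_polyMleq _ _) _; rewrite size_polyX.
Qed.

(** Only an upper bound is stated, which holds over any field; the exact degree comes from the [k]
    roots in [poly_eq_prod_roots]. *)
Lemma size_Dpoly k (nu : F) : (size (Dpoly k nu) <= k.+1)%N.
Proof.
rewrite (leq_trans (size_polyD _ _)) // geq_max size_polyN.
rewrite (leq_trans (size_polyC_leq1 _)) //= (leq_trans (size_sum _ _ _)) //.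
apply/bigmax_leqP_seq => s; rewrite mem_index_iota => /andP[_ sk] _.
rewrite (leq_trans (size_comp_poly_leq _ _)) // ltnS.
have le1 : ((size (2%:R^-1 *: 'X : {poly F})).-1 <= 1)%N.
  have := size_scale_leq (2%:R^-1 : F) 'X; rewrite size_polyX.
  by case: (size _) => [|[|[]]].
rewrite (leq_trans (leq_mul (leqnn _) le1)) // muln1.
by apply: leq_trans (ltnSE sk); rewrite -subn1 leq_subLR add1n size_chebyshevT.
Qed.

End Chebyshev.

(** * Values at [2 cos x], and roots of unity in trigonometric form *)

Section RealDpoly.
Variable R : realType.
Implicit Types (x nu : R) (n k : nat).

Lemma chebyshevT_cos n x : (chebyshevT R n).[cos x] = cos (n%:R * x).
Proof.
suff [] : (chebyshevT R n).[cos x] = cos (n%:R * x) /\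
  (chebyshevT R n.+1).[cos x] = cos (n.+1%:R * x) by [].
elim: n => [|n [IH1 IH2]]; first by rewrite mul0r cos0 mul1r hornerC hornerX.
split=> //; rewrite [chebyshevT _ _]/(2%:R *: ('X * chebyshevT R n.+1) -
  chebyshevT R n).
rewrite hornerD hornerN hornerZ hornerM hornerX IH1 IH2.
(* Expanding around [(n + 1) x] turns the recursion into
   [cos(u + x) + cos(u - x) = 2 cos u cos x]. *)
have -> : n.+2%:R * x = n.+1%:R * x + x by rewrite -(addn1 n.+1) natrD; ring.
have -> : n%:R * x = n.+1%:R * x - x by rewrite -(addn1 n) natrD; ring.
by rewrite !cosD cosN sinN; ring.
Qed.

(** Each of the [k] terms is [cos (s x) <= 1], so at least [nu / 2] remains. *)
Lemma Dpoly_cos_gt0 k nu x : 0 < nu -> 0 < (Dpoly k nu).[2%:R * cos x].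
Proof.
move=> nu0; rewrite hornerD hornerN hornerC horner_sum subr_gt0.
suff le_k : \sum_(1 <= s < k.+1)
    (chebyshevT R s \Po (2%:R^-1 *: 'X)).[2%:R * cos x] <= k%:R.
  by rewrite (le_lt_trans le_k) // ltrDl divr_gt0.
have -> : (k%:R : R) = \sum_(1 <= s < k.+1) 1.
  by rewrite sumr_const_nat subn1.
apply: ler_sum => s _; rewrite horner_comp hornerZ hornerX mulKf ?pnatr_eq0 //.
by rewrite chebyshevT_cos cos_le1.
Qed.

Lemma DpolyC_cos_neq0 k nu x : 0 < nu ->
  (DpolyC k nu).[(2%:R * cos x)%:C] != 0.
Proof.
move=> nu0; rewrite /DpolyC (horner_map (real_complex R)).
by rewrite fmorph_eq0 gt_eqF ?Dpoly_cos_gt0.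
Qed.

Definition cis x : R[i] := cos x +i* sin x.

Lemma cisX x n : cis x ^+ n = cis (n%:R * x).
Proof.
elim: n => [|n IH]; first by rewrite expr0 mul0r /cis cos0 sin0.
rewrite exprS IH -(addn1 n) natrD mulrDl mul1r addrC /cis cosD sinD.
by simpc; congr (_ +i* _); ring.
Qed.

Lemma cisV x : (cis x)^-1 = cis (- x).
Proof.
apply: mulr1_eq; rewrite /cis cosN sinN; simpc.
by rewrite -!expr2 cos2Dsin2 mulrC addNr.
Qed.

Lemma cisDV x : cis x + (cis x)^-1 = (2%:R * cos x)%:C.
Proof.
rewrite cisV /cis cosN sinN; apply/eqP.
rewrite eq_complex /= subrr eqxx andbT.
by rewrite mulr_natl.
Qed.

(** If the order [q] were smaller than [n], then [y = q pi / n] would lie strictly between 0 and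
    [pi] with [cos (2 y) = 1], against [cos (2 y) = 1 - 2 sin^2 y < 1]. *)
Lemma cis_primitive_root n : (0 < n)%N ->
  n.-primitive_root (cis (2%:R * pi / n%:R)).
Proof.
move=> n_gt0; have n0 : (n%:R : R) != 0 by rewrite pnatr_eq0 -lt0n.
have [|q q_prim q_dvd] := @prim_order_exists _ n (cis (2%:R * pi / n%:R)) n_gt0.
  by rewrite cisX mulrC divfK // mulr_natl /cis cos2pi sin2pi.
have [eq_qn | qn] := eqVneq q n; first by rewrite -{1}eq_qn.
have q_lt : (q < n)%N by rewrite ltn_neqAle qn dvdn_leq.
have q_gt0 := prim_order_gt0 q_prim.
have := prim_expr_order q_prim; rewrite cisX => -[+ _].
have -> : q%:R * (2%:R * pi / n%:R) = (q%:R / n%:R * pi) *+ 2 :> R.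
  by rewrite -mulr_natl; ring.
set y : R := q%:R / n%:R * pi.
have : 0 < sin y.
  apply: sin_gt0_pi; rewrite mulr_gt0 ?pi_gt0 ?divr_gt0 ?ltr0n //=.
  by rewrite gtr_pMl ?pi_gt0 // ltr_pdivrMr ?ltr0n // mul1r ltr_nat.
move=> sy; rewrite cos_mulr2n cos2sin2 => c1.
have : 0 < sin y ^+ 2 by rewrite exprn_gt0.
by lra.
Qed.

End RealDpoly.

(** * Cosine sums over the angles [theta_j] *)

Section CosineSums.
Variables (R : realType) (N : nat).
Hypothesis N_gt0 : (0 < N)%N.

Let w : R[i] := cis (2%:R * pi / N%:R).

Let wX j : w ^+ j = cis (theta R N j).
Proof. by rewrite cisX /theta; congr cis; ring. Qed.

Let w_prim : N.-primitive_root w.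
Proof. exact: cis_primitive_root. Qed.

(** Asking for nonvanishing at every real [x] keeps [rho] off the unit circle, so both factors in
    the denominator of [Gfun] are nonzero. *)
Lemma Gfun_cosine (rho : R[i]) (l : nat) :
  rho != 0 -> (forall x, (2%:R * cos x)%:C - (rho + rho^-1) != 0) ->
  (l < N)%N ->
  \sum_(j < N) (cos (l%:R * theta R N j))%:C
      / ((2%:R * cos (theta R N j))%:C - (rho + rho^-1))
  = - Gfun N rho l.
Proof.
move=> rho0 nz lN.
have rho_cis x : rho != cis x.
  by apply: contra (nz x) => /eqP ->; rewrite cisDV subrr.
have rhoV : rho - rho^-1 != 0.
  (* The angles 0 and [pi] exclude [rho = 1] and [rho = -1], the only solutions of
     [rho = rho^-1]. *)
  have := rho_cis 0; have := rho_cis pi.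
  rewrite /cis cos0 sin0 cospi sinpi => h1 h2.
  apply/negP; rewrite subr_eq0 => /eqP e.
  have : rho ^+ 2 == 1 by rewrite expr2 {2}e divff.
  rewrite sqrf_eq1 (negPf h2) /= => /eqP e'.
  by move: h1; rewrite e' eq_complex /= oppr0 !eqxx.
have rhoN : rho ^+ N != 1.
  by apply/eqP => /(prim_rootP w_prim) [j /eqP]; rewrite wX (negPf (rho_cis _)).
have den j : w ^+ j + (w ^+ j)^-1 = (2%:R * cos (theta R N j))%:C.
  by rewrite wX cisDV.
have denV j : w^-1 ^+ j + (w^-1 ^+ j)^-1 = (2%:R * cos (theta R N j))%:C.
  by rewrite exprVn invrK addrC den.
have two0 : (2%:R : R[i]) != 0 by rewrite pnatr_eq0.
(* Twice the cosine is the sum of the [l]-th powers of [w ^+ j] and its inverse, and the denominator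
   is the same for [w] and [w^-1]. *)
apply: (mulfI two0).
have -> : 2%:R * - Gfun N rho l = - Gfun N rho l + - Gfun N rho l by ring.
rewrite -{1}(Gfun_fourier w_prim) //; last by move=> j; rewrite den.
rewrite -(Gfun_fourier (primitive_rootV w_prim)) //; last first.
  by move=> j; rewrite denV.
rewrite mulr_sumr -big_split; apply: eq_bigr => j _ /=.
rewrite den denV mulrA -mulrDl; congr (_ / _).
by rewrite !exprVn wX cisX cisDV rmorphM /= rmorph_nat.
Qed.

(** The contribution of one eigenvalue, with [x] and [y] standing for the projection entries at
    [(b, b)] and [(a, b)]. *)
Lemma Dpoly_cosine_sum (k l : nat) (nu x y : R) (phi rho : 'I_k -> R[i]) :
  (0 < k)%N -> 0 < nu -> enumerates_roots (DpolyC k nu) phi ->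
  (forall c, rho c != 0) -> (forall c, rho c + (rho c)^-1 = phi c) ->
  (l < N)%N ->
  (\sum_(j < N) (x - y * cos (l%:R * theta R N j))
     / (Dpoly k nu).[2%:R * cos (theta R N j)])%:C
  = - \sum_(c < k) (x%:C * Gfun N (rho c) 0 - y%:C * Gfun N (rho c) l)
        / (DpolyC k nu)^`().[phi c].
Proof.
move=> k_gt0 nu_gt0 [phi_inj phi_root] rho0 rhoP lN.
have phi_root' c : root (DpolyC k nu) (phi c) by apply/phi_root; exists c.
have nz c u : (2%:R * cos u)%:C - (rho c + (rho c)^-1) != 0.
  rewrite subr_eq0 rhoP; apply: contra (DpolyC_cos_neq0 k u nu_gt0) => /eqP ->.
  exact: phi_root'.
have D0 : DpolyC k nu != 0.
  by apply: contra (DpolyC_cos_neq0 k 0 nu_gt0) => /eqP ->; rewrite horner0.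
have sizeD : (size (DpolyC k nu) <= k.+1)%N by rewrite size_map_poly size_Dpoly.
rewrite rmorph_sum /=.
(* Writing the constant term with [cos (0 * theta_j)] makes it the case [l = 0] of [Gfun_cosine],
   the source of [Gfun N (rho c) 0]. *)
transitivity (\sum_(j < N) \sum_(c < k)
   (x%:C * (cos (0%:R * theta R N j))%:C - y%:C * (cos (l%:R * theta R N j))%:C)
   / ((2%:R * cos (theta R N j))%:C - (rho c + (rho c)^-1))
   / (DpolyC k nu)^`().[phi c]).
  apply: eq_bigr => j _; rewrite mul0r cos0 mulr1 rmorphM /= fmorphV /=.
  rewrite -(horner_map (real_complex R)) -/(DpolyC k nu).
  rewrite (inv_horner_partial_fractions D0 sizeD phi_inj phi_root') ?DpolyC_cos_neq0 // mulr_sumr.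
  apply: eq_bigr => c _; rewrite rhoP invfM rmorphB rmorphM /=; ring.
rewrite exchange_big -sumrN; apply: eq_bigr => c _ /=.
rewrite -mulNr -mulr_suml; congr (_ / _).
have -> : - (x%:C * Gfun N (rho c) 0 - y%:C * Gfun N (rho c) l)
  = x%:C * - Gfun N (rho c) 0 - y%:C * - Gfun N (rho c) l by ring.
rewrite -!Gfun_cosine // !mulr_sumr -sumrB; apply: eq_bigr => j _.
by rewrite !mulrA -mulrBl.
Qed.

End CosineSums.

(** * Summation over the positive Laplacian eigenvalues *)

Theorem proposition4p6 (R : realType) (N k m r t : nat) (e : rel 'I_m)
    (nu : 'I_t.+1 -> R) (phi rho : 'I_t.+1 -> 'I_k -> R[i])
    (N_gt0 : (0 < N)%N) (k_gt0 : (0 < k)%N) (leN : (2 * k + 1 <= N)%N)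
    (e_simple : simple_graph e) (e_conn : connected_graph e)
    (e_reg : regular_graph e r)
    (nuP : distinct_eigenvalues (laplacian R r e) nu)
    (D_simple : forall alpha : 'I_t.+1, (0 < alpha)%N ->
      all_roots_simple (DpolyC k (nu alpha)))
    (phiP : forall alpha : 'I_t.+1, (0 < alpha)%N ->
      enumerates_roots (DpolyC k (nu alpha)) (phi alpha))
    (rho_neq0 : forall (alpha : 'I_t.+1) (c : 'I_k), (0 < alpha)%N ->
      rho alpha c != 0)
    (rhoP : forall (alpha : 'I_t.+1) (c : 'I_k), (0 < alpha)%N ->
      rho alpha c + (rho alpha c)^-1 = phi alpha c)
    (a b : 'I_m) (l : nat) (lN : (l <= N - 1)%N) :
  (Rsum N k r (laplacian R r e) nu l a b)%:C =
  - ((m * (2 * k + r))%:R / 2%:R *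
     \sum_(alpha < t.+1 | (0 < alpha)%N) \sum_(c < k)
       ((eigenproj (laplacian R r e) (nu alpha) b b)%:C
          * Gfun N (rho alpha c) 0
        - (eigenproj (laplacian R r e) (nu alpha) a b)%:C
          * Gfun N (rho alpha c) l)
       / (DpolyC k (nu alpha))^`().[phi alpha c]).
Proof.
(* The eigenvalues increase strictly from [nu ord0 = 0]; the vertex [a] ensures that the all-ones
   eigenvector is nonzero. *)
have nu_gt0 (alpha : 'I_t.+1) : (0 < alpha)%N -> 0 < nu alpha.
  move=> alpha_gt0; have [inc _] := nuP.
  by rewrite -(distinct_eigenvalues_laplacian0 a e_simple e_reg nuP); apply: inc.
rewrite /Rsum rmorphM rmorph_sum -mulrN -sumrN /=; congr (_ * _).
  by rewrite rmorphM fmorphV !rmorph_nat.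
apply: eq_bigr => alpha alpha_gt0; apply: Dpoly_cosine_sum => //.
- exact: nu_gt0.
- exact: phiP.
- by move=> c; apply: rho_neq0.
- by move=> c; apply: rhoP.
- by rewrite (leq_ltn_trans lN) // subn1 prednK.
Qed.
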